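(* For the uniform distribution $X=U[0,1]$, the competitive ratio of the best online algorithm for sequential employment is $\Theta(\sqrt{n}/\log n)$; that is, $\mathbf{E}_n/\mathbf{E}[\textsc{Opt}_n]=\Theta(\sqrt{n}/\log n)$ as $n\to\infty$, where $\mathbf{E}_n$ is the minimum expected cost of an online algorithm under sequential employment and $\textsc{Opt}_n$ is the offline optimum.
   Context: Online hiring problem: there are $n$ time steps; in time step $i$ applicant $i$ arrives and its cost $x_i$ is revealed, with $x_1,\dots,x_n$ drawn independently from $X$. Immediately and irrevocably at time $i$, based only on $x_1,\dots,x_i$ and earlier decisions, the algorithm chooses a nonnegative integer duration $t_i$; applicant $i$ is then under contract during time steps $i,\dots,i+t_i-1$; the cost is $\sum_i t_ix_i$. Under sequential employment, at every time step $s\in\{1,\dots,n\}$ exactly one applicant is under contract (contracts may not overlap and must cover all time steps). $\textsc{Opt}_n$ is the minimum cost, knowing all $x_1,\dots,x_n$ in advance, of a solution in which at least one applicant is under contract at every time step $s\in\{1,\dots,n\}$. *)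

(* Defs.v *)
From HB Require Import structures.
From mathcomp Require Import all_boot all_order all_algebra.
From mathcomp Require Import all_classical all_reals all_analysis.

Set Implicit Arguments.
Unset Strict Implicit.
Unset Printing Implicit Defensive.

Import Order.TTheory GRing.Theory Num.Theory.
Import numFieldNormedType.Exports.

Local Open Scope classical_set_scope.
Local Open Scope ring_scope.

Section iid_samples.
Context {d : measure_display} {T : measurableType d} {R : realType}.

Definition tuple_cons (n : nat) (z : T * n.-tuple T) : n.+1.-tuple T :=
  [the n.+1.-tuple T of z.1 :: z.2].

Lemma measurable_tuple_cons (n : nat) :
  measurable_fun [set: T * n.-tuple T] (@tuple_cons n).
Proof. exact: measurable_cons. Qed.

HB.instance Definition _ (n : nat) :=
  isMeasurableFun.Build _ _ _ _ (@tuple_cons n) (@measurable_tuple_cons n).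

(* The [n]-fold product of [P]: the joint law of [n] independent samples of [P]
   (see [iid_prob_box]). *)
Fixpoint iid_prob (P : probability T R) (n : nat) :
    probability (n.-tuple T) R :=
  match n with
  | 0 => \d_ [tuple of [::]]
  | m.+1 => distribution (P \x iid_prob P m)%E (@tuple_cons m)
  end.

Lemma iid_prob_box (P : probability T R) (n : nat) (A : 'I_n -> set T) :
  (forall i, measurable (A i)) ->
  iid_prob P n [set x | forall i, A i (tnth x i)] = (\prod_(i < n) P (A i))%E.
Proof.
elim: n A => [A _|n IHn A mA].
  rewrite big_ord0 /= diracE mem_set//; by case.
pose A' (i : 'I_n) := A (lift ord0 i).
rewrite big_ord_recl -(IHn A') => [|i]; last exact: mA.
rewrite [LHS]/= /distribution /pushforward.
rewrite (_ : _ @^-1` _ = A ord0 `*` [set x | forall i, A' i (tnth x i)]).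
  rewrite [LHS]product_measure1E//.
  have -> : [set x | forall i, A' i (tnth x i)] =
      \bigcap_(i in [set: 'I_n]) ((@tnth n T ^~ i) @^-1` A' i).
    by apply/seteqP; split => x /= h i; [move=> _|]; exact: h.
  apply: fin_bigcap_measurable => // i _.
  by rewrite -[X in measurable X]setTI; apply: measurable_tnth => //; exact: mA.
apply/seteqP; split => -[x y] /=.
  by move=> h; split=> [|i]; [have := h ord0|have := h (lift ord0 i)];
     rewrite /tuple_cons ?tnth0 ?tnthS.
move=> [h0 h] i; rewrite /tuple_cons; case: (unliftP ord0 i) => [j|] ->.
  by rewrite tnthS; exact: h.
by rewrite tnth0.
Qed.

End iid_samples.

(* Time steps and applicants are numbered from 0. *)
Section hiring.
Context {R : realType} (n : nat).
Implicit Types (x : n.-tuple R) (t : 'I_n -> nat).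

Definition under_contract t (s i : 'I_n) : bool := (i <= s < i + t i)%N.

Definition cost x t : R := \sum_(i < n) (t i)%:R * tnth x i.

Definition covering t : Prop :=
  forall s : 'I_n, exists i : 'I_n, under_contract t s i.

Definition sequential t : Prop :=
  forall s : 'I_n, exists! i : 'I_n, under_contract t s i.

(* The infimum is a minimum when the costs are nonnegative. *)
Definition opt x : R := inf [set cost x t | t in [set t | covering t]].

(* [A xs ts] is the duration chosen by the decision rule [A] when the costs
   revealed so far, the current one included, are [xs] and the earlier decisions
   are [ts]; [decisions A xs k] lists the first [k] decisions. *)
Fixpoint decisions (A : seq R -> seq nat -> nat) (xs : seq R) (k : nat)
    : seq nat :=
  match k with
  | 0 => [::]
  | m.+1 => let ts := decisions A xs m in rcons ts (A (take m.+1 xs) ts)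
  end.

Definition durations (A : seq R -> seq nat -> nat) x : 'I_n -> nat :=
  fun i => nth 0%N (decisions A x n) i.

Definition sequential_online (A : seq R -> seq nat -> nat) : Prop :=
  (forall i : 'I_n, measurable_fun [set: n.-tuple R]
                                   (fun x => durations A x i)) /\
  (forall x, sequential (durations A x)).

End hiring.

Definition uniform01 (R : realType) : probability (measurableTypeR R) R :=
  uniform_prob (@ltr01 R).

(* May be [+oo]: nothing bounds how far the last contract overruns step [n]. *)
Definition expected_cost (R : realType) (n : nat)
    (A : seq R -> seq nat -> nat) : \bar R :=
  'E_(iid_prob (uniform01 R) n)[fun x => cost x (durations A x)]%E.

Definition best_online (R : realType) (n : nat) : \bar R :=
  ereal_inf [set expected_cost n A | A in [set A | sequential_online n A]].

Definition expected_opt (R : realType) (n : nat) : \bar R :=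
  'E_(iid_prob (uniform01 R) n)[fun x => opt x]%E.

(* Main.v *)
Require Import Defs.
From mathcomp Require Import all_boot all_order all_algebra.
From mathcomp Require Import all_classical all_reals all_analysis measurable_realfun.
From mathcomp Require Import ring lra zify.

Import Order.TTheory GRing.Theory Num.Theory.
Import numFieldNormedType.Exports.

Local Open Scope classical_set_scope.
Local Open Scope ring_scope.

(* Each time step [s] is covered offline by some applicant [i <= s], so the
   offline optimum is the sum over [s] of the running minimum of the costs up to
   [s]; this minimum has expectation of order [1 / (s + 1)], whence a harmonic
   sum of order [ln n].

   Online, hiring the first applicant of cost at most [1 / sqrt n] until the end,
   and every earlier one for a single step, costs at most [2 * sqrt n] on
   average.  Conversely, with [c = 1 / 5], any rule facing [n] uncovered steps
   pays at least [c * sqrt n]: if the first of [n + 1] applicants, of cost [x],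
   gets duration [k + 1], then by induction the expected total cost is at least
   [(k + 1) * x + c * sqrt (n - k)], which by concavity of the square root is at
   least [x + c * sqrt n] as soon as [x >= c / sqrt n].  Averaging over [x] gains
   the constant needed to pass from [sqrt n] to [sqrt (n + 1)]. *)

(** * Uniform samples: tail events and integrals over the unit cube *)

Section uniform_samples.
Context {R : realType}.
Local Notation P := (uniform01 R).

Lemma uniform01_ge (a : R) : 0 <= a <= 1 ->
  P [set x | a <= x] = (1 - a)%:E.
Proof.
move=> /andP[a0 a1]; rewrite /uniform01 /= /uniform_prob integral_uniform_pdf.
rewrite (_ : _ `&` _ = `[a, 1]%classic); last first.
  apply/seteqP; split => x /=; rewrite !in_itv/=; first by case=> -> /andP[].
  by move=> /andP[ax ->]; rewrite ax (le_trans a0 ax).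
rewrite (eq_integral (cst 1%E)); last first.
  move=> x; rewrite inE/= in_itv/= => /andP[ax x1].
  by rewrite /uniform_pdf (le_trans a0 ax) x1 subr0 invr1.
rewrite integral_cst//= mul1e lebesgue_measure_itv/= lte_fin.
case: ltP => // /(conj a1)/andP/le_anti ->; by rewrite subrr.
Qed.

Lemma uniform01_itv01 : P [set x | 0 <= x <= 1] = 1%E.
Proof.
rewrite /uniform01 /= /uniform_prob integral_uniform_pdf1 ?ltr01//.
Qed.

Context (n : nat).
Local Notation Pn := (iid_prob P n).

Lemma measurable_box (A : 'I_n -> set (measurableTypeR R)) : (forall i, measurable (A i)) ->
  measurable [set x : n.-tuple (measurableTypeR R) | forall i, A i (tnth x i)].
Proof.
move=> mA.
have -> : [set x | forall i, A i (tnth x i)] =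
    \bigcap_(i in [set: 'I_n]) ((@tnth n R ^~ i) @^-1` A i).
  by apply/seteqP; split => x /= h i; [move=> _|]; exact: h.
apply: fin_bigcap_measurable => // i _.
by rewrite -[X in measurable X]setTI; apply: measurable_tnth => //; exact: mA.
Qed.

(** All expectations below are estimated through linear combinations of indicators of such boxes:
    membership says that the minimum of the first [k] samples is at least [a]. *)
Definition tail_box (k : nat) (a : R) : set (n.-tuple (measurableTypeR R)) :=
  [set x | forall i : 'I_n, (i < k)%N -> a <= tnth x i].

Let side k (a : R) (i : 'I_n) : set (measurableTypeR R) :=
  if (i < k)%N then [set y | a <= y] else setT.

Let measurable_side k a i : measurable (side k a i).
Proof.
rewrite /side; case: ifPn => // _.
by rewrite -set_itvcy; exact: measurable_itv.
Qed.

Let tail_boxE k a : tail_box k a = [set x | forall i, side k a i (tnth x i)].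
Proof.
rewrite /side; apply/seteqP; split => x /= h i; have := h i.
  by case: ifPn => // _; apply.
by move=> + ik; rewrite ik.
Qed.

Lemma measurable_tail_box k a : measurable (tail_box k a).
Proof.
by rewrite tail_boxE; apply: (measurable_box (side k a)) => i.
Qed.

Lemma prob_tail_box k (a : R) : (k <= n)%N -> 0 <= a <= 1 ->
  Pn (tail_box k a) = ((1 - a) ^+ k)%:E.
Proof.
move=> kn a01; rewrite tail_boxE (iid_prob_box _ (A := side k a))//.
rewrite (eq_bigr (fun i : 'I_n => ((if (i < k)%N then 1 - a else 1)%:E : \bar R))).
  rewrite prodEFin -big_mkcond/=.
  by rewrite -(big_ord_widen n (fun=> 1 - a)) // prodr_const card_ord.
move=> i _; rewrite /side; case: ifPn => // _; first exact: uniform01_ge.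
by rewrite probability_setT.
Qed.

(** Tuples range over all real vectors, so the bounds [0 <= x <= 1] on the costs are available only
    off a null set. *)
Lemma ae_unit_cube : {ae Pn, forall x, forall i : 'I_n, 0 <= tnth x i <= 1}.
Proof.
pose A (i : 'I_n) : set (measurableTypeR R) := [set y | 0 <= y <= 1].
pose C : set (n.-tuple (measurableTypeR R)) := [set x | forall i, A i (tnth x i)].
have mA i : measurable (A i).
  rewrite (_ : A i = `[0, 1]%classic); first exact: measurable_itv.
  by apply/seteqP; split=> x /=; rewrite in_itv.
have mC : measurable C by exact: measurable_box.
exists (~` C); split; first exact: measurableC.
  rewrite probability_setC// (iid_prob_box _ mA) big1 ?subee//.
  by move=> i _; exact: uniform01_itv01.
by move=> x /= h /= Cx; apply: h.
Qed.

(** The arbitrary index type lets one identity serve sums over steps, over pairs of a step and a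
    level, and over steps together with a constant term. *)
Lemma integral_tail_boxes (I : Type) (s : seq I) (c : I -> R) (k : I -> nat)
    (a : I -> R) : (forall i, 0 <= c i) -> (forall i, (k i <= n)%N) ->
  (forall i, 0 <= a i <= 1) ->
  (\int[Pn]_x (\sum_(i <- s) c i * \1_(tail_box (k i) (a i)) x)%:E =
   (\sum_(i <- s) c i * (1 - a i) ^+ (k i))%:E)%E.
Proof.
move=> c0 kn a01.
have mf i : measurable_fun [set: n.-tuple (measurableTypeR R)]
    (EFin \o (\1_(tail_box (k i) (a i)) : _ -> R)).
  by apply/measurable_EFinP; apply: measurable_indic; exact: measurable_tail_box.
under eq_integral do rewrite -sumEFin.
rewrite ge0_integral_sum//; last 2 first.
- by move=> i; apply/measurable_EFinP/measurable_funM => //; exact/measurable_EFinP.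
- by move=> i x _; rewrite lee_fin mulr_ge0.
rewrite -sumEFin; apply: eq_bigr => i _.
under eq_integral do rewrite EFinM.
rewrite ge0_integralZl_EFin//; last exact: mf.
rewrite integral_indic//; last exact: measurable_tail_box.
rewrite setIT EFinM; congr (_ * _)%E; exact: prob_tail_box.
Qed.

Lemma measurable_tail_boxes (I : Type) (s : seq I) (c : I -> R) (k : I -> nat)
    (a : I -> R) : measurable_fun [set: n.-tuple (measurableTypeR R)]
  (fun x => \sum_(i <- s) c i * \1_(tail_box (k i) (a i)) x : R).
Proof.
apply: measurable_sum => i; apply: measurable_funM => //.
by apply: measurable_indic; exact: measurable_tail_box.
Qed.

Let unit_cube_ae (Q : n.-tuple (measurableTypeR R) -> Prop) :
  (forall x, (forall i : 'I_n, 0 <= tnth x i <= 1) -> Q x) -> {ae Pn, forall x, Q x}.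
Proof.
move=> h; have [N [mN N0 subN]] := ae_unit_cube.
exists N; split => // x /= nQx; apply: subN => /= x01; exact/nQx/h.
Qed.

Lemma le_integral_unit_cube (f g : n.-tuple (measurableTypeR R) -> R) :
  measurable_fun [set: n.-tuple (measurableTypeR R)] f ->
  measurable_fun [set: n.-tuple (measurableTypeR R)] g ->
  (forall x, 0 <= f x) -> (forall x, 0 <= g x) ->
  (forall x, (forall i : 'I_n, 0 <= tnth x i <= 1) -> f x <= g x) ->
  (\int[Pn]_x (f x)%:E <= \int[Pn]_x (g x)%:E)%E.
Proof.
move=> mf mg f0 g0 fg; apply: ae_ge0_le_integral => //.
- by move=> x _; rewrite lee_fin.
- exact/measurable_EFinP.
- by move=> x _; rewrite lee_fin.
- exact/measurable_EFinP.
by apply: unit_cube_ae => x x01 _; rewrite lee_fin fg.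
Qed.

Lemma eq_integral_unit_cube (f g : n.-tuple (measurableTypeR R) -> R) :
  measurable_fun [set: n.-tuple (measurableTypeR R)] f ->
  measurable_fun [set: n.-tuple (measurableTypeR R)] g ->
  (forall x, (forall i : 'I_n, 0 <= tnth x i <= 1) -> f x = g x) ->
  (\int[Pn]_x (f x)%:E = \int[Pn]_x (g x)%:E)%E.
Proof.
move=> mf mg fg; apply: ae_eq_integral => //; try exact/measurable_EFinP.
by apply: unit_cube_ae => x x01 _; rewrite fg.
Qed.

End uniform_samples.

(** * Running minima and their positions *)

Section running_minimum.
Context {R : realType}.
Implicit Type y : nat -> R.

(** The strict comparison keeps the earliest minimizer on ties, so an applicant is replaced only by
    a strictly cheaper one. *)
Fixpoint argmin_upto y (s : nat) : nat :=
  if s is s'.+1 then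
    let i := argmin_upto y s' in if y s < y i then s else i
  else 0%N.

Definition min_upto y s : R := y (argmin_upto y s).

Lemma argmin_upto_le y s : (argmin_upto y s <= s)%N.
Proof. by elim: s => //= s IH; case: ifPn => // _; exact: leqW. Qed.

Lemma min_upto_le y s i : (i <= s)%N -> min_upto y s <= y i.
Proof.
rewrite /min_upto; elim: s i => [|s IH] i /=; first by rewrite leqn0 => /eqP->.
rewrite leq_eqVlt => /predU1P[->|]; last rewrite ltnS => /IH.
  by case: ltP.
by case: ltP => // /ltW h1 h2; exact: le_trans h1 h2.
Qed.

(** A new position is always the current index, so a position already reached at [s'] and held at
    [s] is held in between. Hence the steps served by one applicant are consecutive. *)
Lemma argmin_upto_const y s s' :
  (argmin_upto y s <= s')%N -> (s' <= s)%N -> argmin_upto y s' = argmin_upto y s.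
Proof.
elim: s => [|s IH] /=; first by rewrite leqn0 => _ /eqP->.
case: (ltP (y s.+1)) => h; last first.
  move=> ls'; rewrite leq_eqVlt => /predU1P[->/=|/IH]; last exact.
  by rewrite ltNge h.
move=> h1 h2; have -> : s' = s.+1 by apply/eqP; rewrite eqn_leq h1 h2.
by rewrite /= h.
Qed.

Lemma min_uptoS y s : min_upto y s.+1 =
  if y s.+1 < min_upto y s then y s.+1 else min_upto y s.
Proof. by rewrite /min_upto /=; case: ifP. Qed.

End running_minimum.

(** * The offline optimum as a sum of running minima *)

Section offline_optimum.
Context {R : realType} {n : nat}.
Implicit Types (x : n.-tuple R) (t : 'I_n -> nat).

Lemma card_contract t (i : 'I_n) : (#|[pred s | under_contract t s i]| <= t i)%N.
Proof.
rewrite cardE -(size_map val) -[leqRHS](size_iota i).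
apply: uniq_leq_size; first by rewrite map_inj_uniq ?enum_uniq//; exact: val_inj.
by move=> _ /mapP[s + ->]; rewrite mem_enum mem_iota inE.
Qed.

Lemma sum_fiber x (g : 'I_n -> 'I_n) :
  \sum_s tnth x (g s) = \sum_i #|[pred s | g s == i]|%:R * tnth x i.
Proof.
rewrite (partition_big g xpredT)//=; apply: eq_bigr => i _.
rewrite (eq_bigr (fun=> tnth x i)) => [|s /eqP->//].
by rewrite sumr_const mulr_natl.
Qed.

(** Charge each step [s] to an applicant [g s] under contract at [s]: then [g s <= s], and applicant
    [i] is charged at most [t i] times. *)
Lemma min_upto_le_cost x t : (forall i, 0 <= tnth x i) -> covering t ->
  \sum_(s < n) min_upto (nth 0 x) s <= cost x t.
Proof.
move=> x0 /choice[g gt].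
apply: (@le_trans _ _ (\sum_s tnth x (g s))).
  apply: ler_sum => s _; rewrite (tnth_nth 0).
  by apply: min_upto_le; have /andP[] := gt s.
rewrite sum_fiber; apply: ler_sum => i _; apply: ler_wpM2r => //.
rewrite ler_nat (leq_trans _ (card_contract t i))//.
by apply: subset_leq_card; apply/fintype.subsetP => s; rewrite !inE => /eqP <-.
Qed.

(* Every running minimum is employed until the next one arrives. *)
Lemma min_upto_cost x : exists2 t, covering t &
  cost x t = \sum_(s < n) min_upto (nth 0 x) s.
Proof.
pose f (s : 'I_n) : 'I_n :=
  Ordinal (leq_ltn_trans (argmin_upto_le (nth 0 x) s) (ltn_ord s)).
exists (fun i => #|[pred s | f s == i]|); last first.
  by rewrite /cost -sum_fiber; apply: eq_bigr => s _; rewrite (tnth_nth 0).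
move=> s; exists (f s); rewrite /under_contract.
have fs : (f s <= s)%N := argmin_upto_le _ _.
(* The fiber of [f s] contains all of [f s, ..., s], so a contract of that length still runs at step
   [s]. *)
rewrite fs/= -ltn_subLR// cardE -(size_map val) -(size_iota (f s) (s - f s).+1).
apply: uniq_leq_size; first exact: iota_uniq.
move=> j; rewrite mem_iota addnS ltnS subnKC// => /andP[fj js].
have jn : (j < n)%N := leq_ltn_trans js (ltn_ord s).
apply/mapP; exists (Ordinal jn) => //; rewrite mem_enum inE; apply/eqP/val_inj.
exact: argmin_upto_const.
Qed.

Lemma opt_ge0E x : (forall i, 0 <= tnth x i) ->
  opt x = \sum_(s < n) min_upto (nth 0 x) s.
Proof.
move=> x0; have [t tc tE] := min_upto_cost x.
have lb : lbound [set cost x t | t in [set t | covering t]]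
    (\sum_(s < n) min_upto (nth 0 x) s).
  by move=> _ [u uc <-]; exact: min_upto_le_cost.
apply/eqP; rewrite eq_le; apply/andP; split.
  by rewrite -tE; apply: ge_inf; [eexists; exact: lb|exists t].
by apply: lb_le_inf => //; exists (cost x t), t.
Qed.

(* The costs are then unbounded below, and [inf] of such a set is [0]. *)
Lemma opt_lt0E x i : tnth x i < 0 -> opt x = 0.
Proof.
move=> xi0; apply: inf_out => -[_ [M lbM]].
(* Hiring everyone for [n] steps covers and costs [C]; [K] further steps of applicant [i] bring the
   cost below the supposed lower bound [M]. *)
pose C := \sum_(j < n) n%:R * tnth x j.
pose K := Num.Def.archi_bound `|(C - M) / - tnth x i|.
have KP : (C - M) / - tnth x i < K%:R.
  by rewrite (le_lt_trans (ler_norm _))// archi_boundP ?normr_ge0.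
have : M <= cost x (fun j => n + (j == i) * K)%N.
  apply: lbM; eexists; last reflexivity.
  move=> s; exists s; rewrite /under_contract leqnn/= -[ltnLHS]addn0.
  by rewrite ltn_add2l addn_gt0 (leq_ltn_trans _ (ltn_ord s)).
rewrite /cost (eq_bigr (fun j => n%:R * tnth x j + (if j == i then K%:R * tnth x j else 0))).
  rewrite big_split/= -/C -big_mkcond big_pred1_eq => h.
  move: KP; rewrite ltr_pdivrMr ?oppr_gt0//; lra.
by move=> j _; case: eqP => _; rewrite ?mul1n ?mul0n ?addr0 ?addn0// natrD mulrDl.
Qed.

(** Wanted for every tuple, not only on the unit cube, because the comparison of integrals asks for
    integrands that are nonnegative everywhere. *)
Lemma opt_ge0 x : 0 <= opt x.
Proof.
have [x0|/existsNP[i /negP]] := pselect (forall i, 0 <= tnth x i); last first.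
  by rewrite -ltNge => /opt_lt0E ->.
rewrite opt_ge0E//; apply: sumr_ge0 => s _.
have fn : (argmin_upto (nth 0%R x) s < n)%N.
  exact: leq_ltn_trans (argmin_upto_le _ _) (ltn_ord s).
by have := x0 (Ordinal fn); rewrite (tnth_nth 0).
Qed.

Lemma measurable_nth k :
  measurable_fun [set: n.-tuple (measurableTypeR R)] (fun x => nth 0 x k : R).
Proof.
have [kn|nk] := ltnP k n.
  rewrite (_ : (fun _ => _) = (@tnth n R ^~ (Ordinal kn))).
    exact: (@measurable_tnth _ (measurableTypeR R)).
  by apply/funext => x; rewrite (tnth_nth 0).
rewrite (_ : (fun _ => _) = cst 0)//.
by apply/funext => x; rewrite nth_default// size_tuple.
Qed.

Lemma measurable_min_upto s :
  measurable_fun [set: n.-tuple (measurableTypeR R)]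
    (fun x => min_upto (nth 0 x) s : R).
Proof.
elim: s => [|s IH]; first exact: measurable_nth.
under eq_fun do rewrite min_uptoS.
apply: measurable_fun_ifT => //; last exact: measurable_nth.
by apply: measurable_fun_ltr => //; exact: measurable_nth.
Qed.

Lemma measurable_opt :
  measurable_fun [set: n.-tuple (measurableTypeR R)] (@opt R n).
Proof.
(* Splitting on the signs of the costs replaces the infimum over all covers by a finite
   expression. *)
rewrite (_ : @opt R n = fun x => if all (fun i => 0 <= nth 0 x i) (iota 0 n)
    then \sum_(s < n) min_upto (nth 0 x) s else 0).
  apply: measurable_fun_ifT => //; last first.
    by apply: measurable_sum => s; exact: measurable_min_upto.
  elim: (iota 0 n) => //= i r IH; apply: measurable_and => //.
  by apply: measurable_fun_ler => //; exact: measurable_nth.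
apply/funext => x; case: ifPn => [/allP h|/allPn[i]].
  by apply: opt_ge0E => i; rewrite (tnth_nth 0) h// mem_iota/= ltn_ord.
rewrite mem_iota => /andP[_ iltn]; rewrite -ltNge => xi.
by apply: (@opt_lt0E x (Ordinal iltn)); rewrite (tnth_nth 0).
Qed.

End offline_optimum.

(** * Thresholds, powers and harmonic sums *)

Section harmonic_estimates.
Context {R : realType}.

(** Discrete layer cake: the sum counts the integers [l < k] lying in [[0, y]]. *)
Lemma le_sum_thresholds (y : R) k : 0 <= y <= k%:R ->
  y <= \sum_(l < k) (l%:R <= y)%R%:R.
Proof.
elim: k => [|k IH] /andP[y0 yk]; first by rewrite big_ord0.
have [yk'|ky] := leP y k%:R.
  rewrite big_ord_recr/= (le_trans (IH _)) ?y0// lerDl; exact: ler0n.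
rewrite (eq_bigr (fun=> 1)) => [|l _]; first by rewrite sumr_const card_ord.
by rewrite (le_trans _ (ltW ky)) // ler_nat -ltnS.
Qed.

Lemma bernoulli_subr (u : R) k : 0 <= u <= 1 -> 1 - k%:R * u <= (1 - u) ^+ k.
Proof.
move=> /andP[u0 u1]; elim: k => [|k IH]; first by rewrite mul0r subr0 expr0.
rewrite exprS (le_trans _ (ler_wpM2l _ IH)) ?subr_ge0//.
have k0 : 0 <= k%:R :> R by [].
rewrite -natr1; nra.
Qed.

(** The inequality [1 + u <= expR u] is used twice: at [u = - l / k] it bounds the power by
    [expR (- l)], and at [u = 1] it gives [2 <= expR 1]. *)
Lemma exprn_sub_div_le (k l : nat) : (l <= k)%N -> (0 < k)%N ->
  (1 - l%:R / k%:R) ^+ k <= 2^-1 ^+ l :> R.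
Proof.
move=> lk k0; have k0' : 0 < k%:R :> R by rewrite ltr0n.
have h0 : 0 <= 1 - l%:R / k%:R :> R.
  by rewrite subr_ge0 ler_pdivrMr// mul1r ler_nat.
rewrite (@le_trans _ _ (expR (- (l%:R / k%:R)) ^+ k))//.
  by apply: lerXn2r; rewrite ?nnegrE ?expR_ge0// expR_ge1Dx.
rewrite -expRM_natl mulrN mulrCA divff ?(gt_eqF k0')// mulr1.
rewrite expRN -[l%:R]mulr1 expRM_natl exprVn lef_pV2 ?posrE ?exprn_gt0 ?expR_gt0//.
by apply: lerXn2r; rewrite ?nnegrE ?expR_ge0// expR_ge1Dx.
Qed.

Lemma sum_half_le2 k : \sum_(l < k) 2^-1 ^+ l <= 2 :> R.
Proof.
suff -> : \sum_(l < k) 2^-1 ^+ l = 2 - 2 * 2^-1 ^+ k :> R.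
  by rewrite gerBl mulr_ge0// exprn_ge0.
elim: k => [|k IH]; first by rewrite big_ord0 expr0 mulr1 subrr.
rewrite big_ord_recr/= IH exprS; lra.
Qed.

Lemma ln_le_harmonic n : ln n.+1%:R <= \sum_(s < n) s.+1%:R^-1 :> R.
Proof.
elim: n => [|n IH]; first by rewrite big_ord0 ln1.
rewrite big_ord_recr/= -natr1.
have -> : n.+1%:R + 1 = n.+1%:R * (1 + n.+1%:R^-1) :> R.
  by rewrite mulrDr mulr1 divff.
rewrite lnM ?posrE ?addr_gt0// lerD// le_ln1Dx//.
by rewrite (lt_trans (ltrN10 _)).
Qed.

(** The inductive step is [ln (1 - u) <= - u] at [u = 1 / (n + 2)]. *)
Lemma harmonic_le_ln n : \sum_(s < n.+1) s.+1%:R^-1 <= 1 + ln n.+1%:R :> R.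
Proof.
elim: n => [|n IH]; first by rewrite big_ord1 ln1 invr1 addr0.
rewrite big_ord_recr/= (le_trans (lerD IH (lexx _)))// -addrA lerD2l.
have e : n.+1%:R = n.+2%:R * (1 - n.+2%:R^-1) :> R.
  by rewrite mulrBr mulr1 divff// -[n.+2%:R]natr1 addrK.
have h : 0 < 1 - n.+2%:R^-1 :> R.
  by rewrite subr_gt0 invf_lt1 ?ltr1n.
rewrite [in ln n.+1%:R]e lnM ?posrE// -addrA gerDl.
have h1 : -1 < - n.+2%:R^-1 :> R by rewrite ltrN2 -subr_gt0.
by rewrite -lerBrDr sub0r; exact: le_ln1Dx.
Qed.

End harmonic_estimates.

(** * The expected offline optimum is of harmonic order *)

Section expected_optimum.
Context {R : realType} (n : nat).
Local Notation Pn := (iid_prob (uniform01 R) n).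

Lemma min_upto_ge (x : n.-tuple R) s a : (s < n)%N ->
  (a <= min_upto (nth 0 x) s) <-> tail_box n s.+1 a x.
Proof.
move=> sn; split => [h i|h].
  by rewrite ltnS (tnth_nth 0) => /(min_upto_le (nth 0 x)); exact: le_trans.
have sn' := leq_ltn_trans (argmin_upto_le (nth 0 x) s) sn.
by have := h (Ordinal sn'); rewrite (tnth_nth 0); apply; exact: argmin_upto_le.
Qed.

(** Markov's inequality at the threshold [c s = 1 / (2 (s + 1))]: by Bernoulli's inequality all
    [s + 1] samples exceed it with probability at least [1 / 2], so step [s] contributes at least
    [1 / (4 (s + 1))]. *)
Lemma expected_opt_ge :
  (((\sum_(s < n) s.+1%:R^-1) / 4)%R%:E <= expected_opt R n)%E.
Proof.
pose c (s : 'I_n) : R := (2 * s.+1%:R)^-1.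
have c0 s : 0 <= c s by rewrite invr_ge0 mulr_ge0.
have c1 s : c s <= 1 by rewrite invf_le1 ?mulr_gt0// -natrM ler1n.
rewrite /expected_opt expectation.unlock.
have := @integral_tail_boxes R n _ (index_enum 'I_n) c (fun s => s.+1) c c0
  (fun s => ltn_ord s) (fun s => introT andP (conj (c0 s) (c1 s))).
move=> E; apply: (@le_trans _ _ (\sum_s c s * (1 - c s) ^+ s.+1)%:E).
  rewrite lee_fin mulr_suml; apply: ler_sum => s _.
  apply: (@le_trans _ _ (c s * (1 - s.+1%:R * c s))).
    rewrite le_eqVlt; apply/predU1P; left; rewrite /c.
    by move: (s.+1%:R : R) (pnatr_eq0 R s.+1) => k k0; field; rewrite k0.
  by rewrite ler_wpM2l// bernoulli_subr// c0 c1.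
rewrite -{}E; apply: le_integral_unit_cube => [|||x|x x01].
- exact: (measurable_tail_boxes n _ _ c (fun s => s.+1) c).
- exact: measurable_opt.
- by move=> x; apply: sumr_ge0 => s _; rewrite mulr_ge0.
- exact: opt_ge0.
have x0 i : 0 <= tnth x i by have /andP[] := x01 i.
rewrite opt_ge0E//; apply: ler_sum => s _; rewrite indicE.
case: (boolP (x \in _)) => [|_].
  by rewrite inE mulr1 => /min_upto_ge; apply.
rewrite mulr0; apply/min_upto_ge => // i _; exact: x0.
Qed.

(** The running minimum times [s + 1] is at most the number of levels [l <= s] with [l / (s + 1)]
    below the minimum. Level [l] is reached with probability at most [2^-l], and these sum to at
    most 2. *)
Lemma expected_opt_le :
  (expected_opt R n <= (2 * \sum_(s < n) s.+1%:R^-1)%R%:E)%E.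
Proof.
pose I := {s : 'I_n & 'I_s.+1}.
pose c (p : I) : R := (tag p).+1%:R^-1.
pose a (p : I) : R := (tagged p)%:R / (tag p).+1%:R.
have c0 p : 0 <= c p by rewrite invr_ge0.
have a01 p : 0 <= a p <= 1.
  rewrite /a divr_ge0//= ler_pdivrMr// mul1r ler_nat; exact/ltnW/ltn_ord.
rewrite /expected_opt expectation.unlock.
have sumI (F : forall s : 'I_n, 'I_s.+1 -> R) :
    \sum_(p : I) F (tag p) (tagged p) = \sum_s \sum_l F s l.
  by rewrite (sig_big_dep xpredT (fun=> xpredT)).
have E := @integral_tail_boxes R n _ (index_enum I) c (fun p => (tag p).+1) a c0
  (fun p => ltn_ord (tag p)) a01.
apply: (@le_trans _ _ (\sum_p c p * (1 - a p) ^+ (tag p).+1)%:E); last first.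
  rewrite lee_fin mulr_sumr.
  rewrite (sumI (fun s (l : 'I_s.+1) => s.+1%:R^-1 * (1 - l%:R / s.+1%:R) ^+ s.+1)).
  apply: ler_sum => s _; rewrite -mulr_sumr mulrC ler_wpM2r//.
  rewrite (le_trans _ (sum_half_le2 s.+1))//; apply: ler_sum => l _.
  by apply: exprn_sub_div_le => //; exact: ltnW.
rewrite -{}E; apply: le_integral_unit_cube => [|||x|x x01].
- exact: measurable_opt.
- exact: (measurable_tail_boxes n _ _ c (fun p => (tag p).+1) a).
- exact: opt_ge0.
- by apply: sumr_ge0 => s _; rewrite mulr_ge0.
have x0 i : 0 <= tnth x i by have /andP[] := x01 i.
rewrite opt_ge0E//.
rewrite (sumI (fun s (l : 'I_s.+1) => s.+1%:R^-1 *
     \1_(tail_box n s.+1 (l%:R / s.+1%:R)) x)).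
apply: ler_sum => s _; rewrite -mulr_sumr mulrC ler_pdivlMr//.
have m01 : 0 <= min_upto (nth 0 x) s <= 1.
  apply/andP; split; first by apply/min_upto_ge => // i _; exact: x0.
  rewrite (le_trans (min_upto_le (nth 0 x) _ _ (leqnn s)))//.
  by have /andP[] := x01 s; rewrite (tnth_nth 0).
rewrite (le_trans (@le_sum_thresholds _ _ s.+1 _))//.
  by move: m01 => /andP[m0 m1]; rewrite mulr_ge0//= ler_piMl.
apply: ler_sum => l _; rewrite indicE -ler_pdivrMr// ler_nat.
by case: leP => // /min_upto_ge h; rewrite mem_set//; apply: h.
Qed.

End expected_optimum.

(** * Online rules and their expected cost *)

Section online_rules.
Context {R : realType} {n : nat}.
Implicit Types (A : seq R -> seq nat -> nat) (x : n.-tuple R).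

Lemma size_decisions A xs k : size (decisions A xs k) = k.
Proof. by elim: k => //= k IH; rewrite size_rcons IH. Qed.

Lemma nth_decisions A xs k i : (i < k)%N ->
  nth 0%N (decisions A xs k) i = A (take i.+1 xs) (decisions A xs i).
Proof.
elim: k => // k IH; rewrite ltnS leq_eqVlt /= nth_rcons size_decisions.
by case/predU1P => [->|ik]; rewrite ?ltnn ?eqxx// ik IH.
Qed.

Lemma durationsE A x (i : 'I_n) :
  durations A x i = A (take i.+1 x) (decisions A x i).
Proof. by rewrite /durations nth_decisions. Qed.

(** Equal to [cost] almost surely under the uniform law, and nonnegative on every tuple, as Tonelli
    and the comparison of integrals require. *)
Definition abs_cost x (t : 'I_n -> nat) : R := \sum_(i < n) (t i)%:R * `|tnth x i|.

Lemma abs_cost_ge0 x t : 0 <= abs_cost x t.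
Proof. by apply: sumr_ge0 => i _; rewrite mulr_ge0. Qed.

Section measurability.
Variable t : n.-tuple R -> 'I_n -> nat.
Hypothesis mt : forall i, measurable_fun [set: n.-tuple R] (fun x => t x i).

Let measurable_natr i :
  measurable_fun [set: n.-tuple (measurableTypeR R)] (fun x => (t x i)%:R : R).
Proof.
have mti : measurable_fun [set: n.-tuple (measurableTypeR R)] (fun x => t x i).
  exact: mt.
have mnat : measurable_fun [set: nat] (fun k : nat => k%:R : R) by [].
exact: (measurableT_comp mnat mti).
Qed.

Let measurable_coord (i : 'I_n) :
  measurable_fun [set: n.-tuple (measurableTypeR R)] (fun x => tnth x i : R).
Proof. exact: (@measurable_tnth _ (measurableTypeR R)). Qed.

Lemma measurable_cost :
  measurable_fun [set: n.-tuple (measurableTypeR R)] (fun x => cost x (t x) : R).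
Proof. by apply: measurable_sum => i; exact: measurable_funM. Qed.

Lemma measurable_abs_cost :
  measurable_fun [set: n.-tuple (measurableTypeR R)] (fun x => abs_cost x (t x) : R).
Proof.
apply: measurable_sum => i; apply: measurable_funM => //.
exact: measurableT_comp.
Qed.

End measurability.

Lemma expected_costE A : sequential_online n A -> expected_cost n A =
  (\int[iid_prob (uniform01 R) n]_x (abs_cost x (durations A x))%:E)%E.
Proof.
move=> [mA _]; rewrite /expected_cost expectation.unlock.
apply: eq_integral_unit_cube => [||x x01].
- exact: measurable_cost.
- exact: measurable_abs_cost.
- by apply: eq_bigr => i _; rewrite ger0_norm//; have /andP[] := x01 i.
Qed.

End online_rules.

(** * The online upper bound: the threshold rule *)

Section threshold_rule.
Context {R : realType} (n : nat) (a : R).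
Implicit Types x : n.-tuple R.

Definition threshold_rule (xs : seq R) (ts : seq nat) : nat :=
  let i := (size xs).-1 in
  if has (fun y => y <= a) (take i xs) then 0%N
  else if nth 0 xs i <= a then (n - i)%N else 1%N.

(** This is [n] when no cost is at most [a]; every applicant then serves a single step. *)
Let hit x := find (fun y => y <= a) x.

Let durations_ruleE x (i : 'I_n) : durations threshold_rule x i =
  if has (fun y => y <= a) (take i x) then 0%N
  else if nth 0 x i <= a then (n - i)%N else 1%N.
Proof.
rewrite durationsE /threshold_rule size_takel ?size_tuple//=.
by rewrite take_takel// nth_take.
Qed.

Let durations_hitE x (i : 'I_n) : durations threshold_rule x i =
  if (hit x < i)%N then 0%N else if i == hit x :> nat then (n - i)%N else 1%N.
Proof.
rewrite durations_ruleE has_take_leq; last by rewrite size_tuple ltnW.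
rewrite -/(hit x).
case: (ltngtP i (hit x)) => //= [ilt|ie].
  by have := before_find 0 ilt => /= ->.
have := @nth_find _ 0 (fun y => y <= a) x; rewrite -/(hit x) -ie => -> //.
by rewrite has_find -/(hit x) -ie size_tuple.
Qed.

Lemma sequential_threshold_rule x : sequential (durations threshold_rule x).
Proof.
move=> s; have [sh|hs] := ltnP s (hit x).
  exists s; split.
    by rewrite /under_contract durations_hitE; move: sh; case: (ltngtP s (hit x)); lia.
  move=> i; rewrite /under_contract durations_hitE => h; apply/val_inj => /=.
  by move: h sh; case: (ltngtP i (hit x)); lia.
have hn : (hit x < n)%N := leq_ltn_trans hs (ltn_ord s).
exists (Ordinal hn); split.
  rewrite /under_contract durations_hitE/= ltnn eqxx hs/= subnKC//; exact: ltnW.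
move=> i; rewrite /under_contract durations_hitE => h; apply/val_inj => /=.
by move: h hs; case: (ltngtP i (hit x)); lia.
Qed.

Lemma sequential_online_threshold_rule : sequential_online n threshold_rule.
Proof.
split; last exact: sequential_threshold_rule.
move=> i.
have mle j : measurable_fun [set: n.-tuple R] (fun x => nth 0 x j <= a).
  by apply: measurable_fun_ler => //; exact: measurable_nth.
rewrite (_ : (fun _ => _) = fun x =>
    if has (fun j => nth 0 x j <= a) (iota 0 i) then 0%N
    else if nth 0 x i <= a then (n - i)%N else 1%N).
  apply: measurable_fun_ifT => //; last exact: measurable_fun_ifT.
  by elim: (iota 0 i) => //= j r IH; exact: measurable_or.
apply/funext => x; rewrite durations_ruleE; congr (if _ then _ else _).
by rewrite -(@map_nth_iota0 _ 0) ?size_tuple 1?ltnW// has_map.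
Qed.

(** The applicant at [hit x] costs at most [n * a]. An earlier one serves one step at cost at most
    1, and all costs up to it exceed [a]. *)
Lemma threshold_rule_cost_le x : 0 <= a ->
  (forall i : 'I_n, 0 <= tnth x i <= 1) ->
  abs_cost x (durations threshold_rule x) <=
  n%:R * a + \sum_(i < n) \1_(tail_box n i.+1 a) x.
Proof.
move=> a0 x01.
apply: (@le_trans _ _ (\sum_(i < n)
    ((if i == hit x :> nat then n%:R * a else 0) + \1_(tail_box n i.+1 a) x))).
  apply: ler_sum => i _; rewrite durations_hitE.
  have /andP[xi0 xi1] := x01 i; rewrite ger0_norm//.
  case: (ltngtP i (hit x)) => /= [ih|hi|ih].
  - rewrite mul1r add0r indicE mem_set// => j; rewrite ltnS => ji.
    have := before_find 0 (leq_ltn_trans ji ih) => /= /negbT.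
    by rewrite -ltNge (tnth_nth 0) => /ltW.
  - by rewrite mul0r add0r.
  - rewrite -[leLHS]addr0 lerD//.
    apply: ler_pM => //; first by rewrite ler_nat leq_subr.
    have := @nth_find _ 0 (fun y => y <= a) x.
    rewrite -/(hit x) -ih (tnth_nth 0) => -> //.
    by rewrite has_find -/(hit x) -ih size_tuple.
rewrite big_split/= lerD2r -big_mkcond/=.
have [hn|nh] := ltnP (hit x) n.
  by rewrite (big_pred1 (Ordinal hn)).
rewrite big_pred0 ?mulr_ge0// => i.
by apply/negbTE; rewrite neq_ltn (leq_trans (ltn_ord i) nh).
Qed.

Lemma expected_cost_threshold_rule : 0 < a <= 1 ->
  (expected_cost n threshold_rule <= (n%:R * a + a^-1)%R%:E)%E.
Proof.
move=> /andP[a0 a1]; rewrite expected_costE; last exact: sequential_online_threshold_rule.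
(* The index [None] carries the constant [n * a], as the coefficient of a box with [k = 0], which is
   the whole space. *)
pose s := None :: map Some (index_enum 'I_n).
pose c (o : option 'I_n) : R := if o is Some i then 1 else n%:R * a.
pose k (o : option 'I_n) : nat := if o is Some i then i.+1 else 0%N.
pose b (o : option 'I_n) : R := if o is Some i then a else 0.
have c0 o : 0 <= c o by case: o => [i|]//=; rewrite mulr_ge0// ltW.
have kn o : (k o <= n)%N by case: o => [i|] //=.
have b01 o : 0 <= b o <= 1 by case: o => [i|]//=; rewrite ?lexx ?ler01// ltW// a1.
have E := @integral_tail_boxes R n _ s c k b c0 kn b01.
apply: (@le_trans _ _ (\sum_(o <- s) c o * (1 - b o) ^+ k o)%:E); last first.
  rewrite lee_fin big_cons/= expr0 mulr1 lerD2l big_map /=.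
  under eq_bigr do rewrite mul1r.
  rewrite -[a^-1]mul1r ler_pdivlMr// mulrC.
  suff -> : a * \sum_(i < n) (1 - a) ^+ i.+1 = (1 - a) - (1 - a) ^+ n.+1.
    have : 0 <= (1 - a) ^+ n.+1 by rewrite exprn_ge0// subr_ge0.
    by lra.
  elim: n => [|m IH]; first by rewrite big_ord0 mulr0 expr1 subrr.
  by rewrite big_ord_recr/= mulrDr IH [in RHS]exprS; ring.
rewrite -{}E; apply: le_integral_unit_cube => [|||x|x x01].
- by apply: measurable_abs_cost; have [] := sequential_online_threshold_rule.
- exact: (measurable_tail_boxes n _ s c k b).
- by move=> x; exact: abs_cost_ge0.
- by apply: sumr_ge0 => o _; rewrite mulr_ge0.
rewrite (le_trans (threshold_rule_cost_le _ (ltW a0) x01))//.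
rewrite big_cons big_map /= lerD//; last by apply: ler_sum => i _; rewrite mul1r.
by rewrite indicE mem_set ?mulr1.
Qed.

End threshold_rule.

(** The threshold [1 / sqrt n] balances the terms [n * a] and [a^-1]. *)
Lemma best_online_le (R : realType) (n : nat) : (0 < n)%N ->
  (best_online R n <= (2 * Num.sqrt n%:R)%R%:E)%E.
Proof.
move=> n0; have s1 : 1 <= Num.sqrt n%:R :> R.
  by rewrite -[leLHS]sqrtr1 ler_wsqrtr// ler1n.
have s0 := lt_le_trans ltr01 s1.
apply: (@le_trans _ _ (expected_cost n (threshold_rule n (Num.sqrt n%:R)^-1))).
  apply: ereal_inf_lbound; exists (threshold_rule n (Num.sqrt n%:R)^-1) => //.
  exact: sequential_online_threshold_rule.
rewrite (le_trans (expected_cost_threshold_rule _ _ _))//.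
  by rewrite invr_gt0 s0 invf_le1.
have e : n%:R = Num.sqrt n%:R * Num.sqrt n%:R :> R by rewrite -expr2 sqr_sqrtr.
rewrite lee_fin invrK {1}e mulfK ?gt_eqF//.
by rewrite mulr_natl mulr2n.
Qed.

(** * Integrating over the first sample separately *)

Section tonelli_cons.
Context {d : measure_display} {T : measurableType d} {R : realType}.
Variables (P : probability T R) (n : nat) (f : n.+1.-tuple T -> \bar R).
Hypotheses (mf : measurable_fun [set: n.+1.-tuple T] f) (f0 : forall x, (0 <= f x)%E).

Let mfc : measurable_fun [set: T * n.-tuple T] (f \o @tuple_cons d T n).
Proof. by apply: measurableT_comp => //; exact: measurable_tuple_cons. Qed.

Lemma integral_iid_probS :
  (\int[iid_prob P n.+1]_x f x = \int[P]_x \int[iid_prob P n]_y f (tuple_cons (x, y)))%E.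
Proof.
rewrite /= ge0_integral_distribution//.
have fc0 z : (0 <= (f \o @tuple_cons d T n) z)%E by exact: f0.
exact: (@fubini_tonelli1 _ _ _ _ _ P (iid_prob P n) _ mfc fc0).
Qed.

Lemma measurable_integral_iid_prob :
  measurable_fun [set: T] (fun x => \int[iid_prob P n]_y f (tuple_cons (x, y)))%E.
Proof.
by apply: (@measurable_fun_fubini_tonelli_F _ _ _ _ _ (iid_prob P n) _ mfc) => z; exact: f0.
Qed.

End tonelli_cons.

(** * Sequential employment while an earlier contract still covers the first [j] steps *)

Definition sequential_from (n j : nat) (t : 'I_n -> nat) : Prop :=
  forall s : 'I_n, if (s < j)%N then forall i, ~~ under_contract t s i
                   else exists! i, under_contract t s i.

Lemma sequential_from0 n (t : 'I_n -> nat) : sequential t -> sequential_from n 0 t.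
Proof. by move=> h s; exact: h. Qed.

Lemma sequential_from_head n j (t : 'I_n.+1 -> nat) :
  sequential_from n.+1 j t -> (0 < t ord0)%N = (j == 0%N).
Proof.
case: j => [|j] /(_ ord0)/=.
  move=> [i [+ _]]; rewrite /under_contract leqn0 => /andP[/eqP i0].
  by rewrite (_ : i = ord0) ?add0n//; exact: val_inj.
by move=> /(_ ord0); rewrite /under_contract/= add0n => /negbTE.
Qed.

(** Exactly one of [j] and [t ord0] is nonzero, so [j + t ord0] is the length of the contract
    running at the first step, and one step of it is used up. *)
Lemma sequential_from_behead n j (t : 'I_n.+1 -> nat) :
  sequential_from n.+1 j t ->
  sequential_from n (j + t ord0).-1 (fun i => t (lift ord0 i)).
Proof.
move=> h s; have t0 := sequential_from_head n j t h.
have ucE i : under_contract (fun i => t (lift ord0 i)) s i =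
    under_contract t (lift ord0 s) (lift ord0 i).
  by rewrite /under_contract !lift0 addSn !ltnS.
have uc0 : under_contract t (lift ord0 s) ord0 = (s.+1 < t ord0)%N.
  by rewrite /under_contract lift0 leq0n add0n.
have := h (lift ord0 s); rewrite lift0.
case: j t0 {h} => [|j] /= t0.
  move=> [i [ci ui]]; rewrite add0n; case: ifPn => st.
    move=> k; rewrite ucE; apply/negP => ck.
    have /ui i0 : under_contract t (lift ord0 s) ord0 by rewrite uc0; lia.
    by have /ui := ck; rewrite i0 => /eqP; rewrite (negbTE (neq_lift _ _)).
  case: (unliftP ord0 i) ci ui => [k|] -> ci ui; last first.
    by move: ci; rewrite uc0; lia.
  exists k; split; first by rewrite ucE.
  by move=> l; rewrite ucE => /ui/lift_inj.
have -> : t ord0 = 0%N by lia.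
rewrite addn0 /= ltnS; case: ifPn => sj.
  by move=> hn i; rewrite ucE.
move=> [i [ci ui]]; case: (unliftP ord0 i) ci ui => [k|] -> ci ui; last first.
  by move: ci; rewrite uc0; lia.
exists k; split; first by rewrite ucE.
by move=> l; rewrite ucE => /ui/lift_inj.
Qed.

(** * Square root estimates *)

Section square_root_estimates.
Context {R : realType}.

(* For [k <= n] this compares the concave square root with its chord on [0, n]. *)
Lemma sqrt_chord (n k : nat) : (0 < n)%N ->
  Num.sqrt n%:R <= k%:R / Num.sqrt n%:R + Num.sqrt (n - k)%:R :> R.
Proof.
move=> n0; have s0 : 0 < Num.sqrt n%:R :> R by rewrite sqrtr_gt0 ltr0n.
have e m : Num.sqrt m%:R * Num.sqrt m%:R = m%:R :> R by rewrite -expr2 sqr_sqrtr.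
rewrite -(ler_pM2r s0) mulrDl divfK ?gt_eqF// e.
have [nk|kn] := leqP n k.
  by rewrite -[leLHS]addr0 lerD ?ler_nat// mulr_ge0 ?sqrtr_ge0.
rewrite -lerBlDl -natrB ?(ltnW kn)// -[leLHS]e ler_wpM2l ?sqrtr_ge0//.
by rewrite ler_wsqrtr// ler_nat leq_subr.
Qed.

Lemma sqrtS_le (n : nat) : Num.sqrt n.+1%:R <= Num.sqrt n%:R + 1 :> R.
Proof.
have s0 : 0 <= Num.sqrt n%:R :> R := sqrtr_ge0 _.
rewrite -(@ler_pXn2r _ 2)// ?nnegrE ?sqrtr_ge0 ?addr_ge0//.
rewrite sqrrD !sqr_sqrtr// mulr1 expr1n -natr1 lerD2r lerDl.
by rewrite mulrn_wge0.
Qed.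

End square_root_estimates.

Lemma integral_probability_cst (d : measure_display) (T : measurableType d)
  (R : realType) (Q : probability T R) (r : R) : (\int[Q]_x r%:E = r%:E)%E.
Proof. by have := expectation_cst Q r; rewrite expectation.unlock. Qed.

(** * The online lower bound by induction on the number of applicants *)

Section online_lower_bound.
Context {R : realType}.
Local Notation P := (uniform01 R).

Let ge (a : R) : set (measurableTypeR R) := [set y | a <= y].

(* The constant [c = 5^-1] is chosen so that [c + c ^+ 2 <= 4^-1]. *)
Let step_bound (n : nat) (y : measurableTypeR R) : R :=
  2^-1 * \1_(ge 2^-1) y +
  (5^-1 * Num.sqrt n%:R) * \1_(ge (5^-1 / Num.sqrt n%:R)) y.

(** The bound does not depend on the duration [k.+1]. One step of the contract pays for the first
    indicator; by [sqrt_chord] the other [k] steps and the remaining [n - k] pay for the second. *)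
Let step_bound_le n k y :
  step_bound n y <= k.+1%:R * `|y| + 5^-1 * Num.sqrt (n - k)%:R.
Proof.
have y0 : 0 <= `|y| by [].
have yy := ler_norm y.
have s0 m : 0 <= Num.sqrt m%:R :> R := sqrtr_ge0 _.
rewrite -natr1 mulrDl mul1r addrAC addrC /step_bound lerD//.
  rewrite indicE; case: (boolP (y \in _)) => [|_]; last by rewrite mulr0.
  by rewrite inE/= mulr1 => /le_trans; apply.
rewrite indicE; case: (boolP (y \in _)) => [|_]; last first.
  by rewrite mulr0 addr_ge0 ?mulr_ge0.
rewrite inE/= mulr1 => /le_trans/(_ yy) ty.
case: n ty => [|n] ty; first by rewrite sqrtr0 mulr0 addr_ge0 ?mulr_ge0.
apply: (@le_trans _ _ (5^-1 * (k%:R / Num.sqrt n.+1%:R + Num.sqrt (n.+1 - k)%:R))).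
  by rewrite ler_wpM2l// sqrt_chord.
by rewrite mulrDr lerD2r mulrCA ler_wpM2l.
Qed.

Let measurable_ge (a : R) : measurable (ge a).
Proof. by rewrite /ge -set_itvcy; exact: measurable_itv. Qed.

Let measurable_step_bound n :
  measurable_fun [set: measurableTypeR R] (step_bound n).
Proof.
by apply: measurable_funD; apply: measurable_funM => //;
  apply: measurable_indic; exact: measurable_ge.
Qed.

(** With [c = 5^-1], the integral is at least [1 / 4 + c * sqrt n - c ^+ 2], hence at least
    [c * (sqrt n + 1)]. *)
Let integral_step_bound n :
  ((5^-1 * Num.sqrt n.+1%:R)%R%:E <= \int[P]_y (step_bound n y)%:E)%E.
Proof.
have s0 m : 0 <= Num.sqrt m%:R :> R := sqrtr_ge0 _.
have t01 : 0 <= (5^-1 : R) / Num.sqrt n%:R <= 1.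
  rewrite divr_ge0//=; case: n => [|n]; first by rewrite sqrtr0 invr0 mulr0.
  have s1 : 1 <= Num.sqrt n.+1%:R :> R.
    by rewrite -[leLHS]sqrtr1 ler_wsqrtr// ler1n.
  rewrite ler_pdivrMr ?(lt_le_trans ltr01)// mul1r (le_trans _ s1)//.
  by rewrite invf_le1// ler1n.
have m1 (c a : R) : measurable_fun [set: measurableTypeR R]
    (fun y => (c * \1_(ge a) y)%:E).
  by apply/measurable_EFinP; apply: measurable_funM.
have i1 (c a : R) : 0 <= c -> 0 <= a <= 1 ->
    (\int[P]_y (c * \1_(ge a) y)%:E = (c * (1 - a))%R%:E)%E.
  move=> c0 a01; under eq_integral do rewrite EFinM.
  rewrite ge0_integralZl_EFin//; last exact/measurable_EFinP.
  rewrite integral_indic//.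
  by rewrite setIT EFinM; congr (_ * _)%E; exact: uniform01_ge.
under eq_integral do rewrite EFinD.
rewrite ge0_integralD//.
rewrite (i1 2^-1)//; last by rewrite invr_ge0 ler0n invf_le1// ler1n.
rewrite i1// -EFinD lee_fin.
have := @sqrtS_le R n.
have : Num.sqrt n%:R / Num.sqrt n%:R <= 1 :> R.
  have [->|/divff->//] := eqVneq (Num.sqrt n%:R : R) 0; by rewrite mul0r.
by move: (Num.sqrt _)^-1 => r; nra.
Qed.

(** Families of durations replace rules so that fixing the first cost leaves an object of the same
    kind; the second hypothesis says that they do not look ahead. *)
Lemma abs_cost_lower_bound n j (t : n.-tuple R -> 'I_n -> nat) :
  (forall i, measurable_fun [set: n.-tuple (measurableTypeR R)] (fun x => t x i)) ->
  (forall (x y : n.-tuple R) (i : 'I_n), take i.+1 x = take i.+1 y -> t x i = t y i) ->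
  (forall x, sequential_from n j (t x)) ->
  ((5^-1 * Num.sqrt (n - j)%:R)%R%:E <=
    \int[iid_prob P n]_x (abs_cost x (t x))%:E)%E.
Proof.
elim: n j t => [|n IH] j t mt ant seqt.
  rewrite sub0n sqrtr0 mulr0; apply: integral_ge0 => x _.
  by rewrite lee_fin abs_cost_ge0.
have mf : measurable_fun [set: n.+1.-tuple (measurableTypeR R)]
    (fun x => (abs_cost x (t x))%:E).
  by apply/measurable_EFinP; exact: measurable_abs_cost.
have f0 x : (0 <= (abs_cost x (t x))%:E)%E by rewrite lee_fin abs_cost_ge0.
rewrite (integral_iid_probS P n _ mf f0).
(* The first duration depends on the first cost alone, so an arbitrary tail serves to define it. *)
pose y0 : n.-tuple R := [tuple of nseq n 0].
pose t0 (x : R) := t (tuple_cons (x, y0)) ord0.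
have t0E x y : t (tuple_cons (x, y)) ord0 = t0 x.
  by apply: ant; rewrite /= !take0.
pose t' (x : R) (y : n.-tuple R) (i : 'I_n) := t (tuple_cons (x, y)) (lift ord0 i).
have costE x y : abs_cost (tuple_cons (x, y)) (t (tuple_cons (x, y))) =
    (t0 x)%:R * `|x| + abs_cost y (t' x y).
  rewrite /abs_cost big_ord_recl t0E tnth0; congr (_ + _).
  by apply: eq_bigr => i _; rewrite tnthS.
have mt' x i : measurable_fun [set: n.-tuple (measurableTypeR R)] (fun y => t' x y i).
  have mc : measurable_fun [set: n.-tuple (measurableTypeR R)]
      (fun y => @tuple_cons _ (measurableTypeR R) n (x, y)).
    exact: (@measurable_cons _ _ _ (measurableTypeR R) (cst x) n id).
  exact: (measurableT_comp (mt (lift ord0 i)) mc).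
have step x : (((t0 x)%:R * `|x| + 5^-1 * Num.sqrt (n - (j + t0 x).-1)%:R)%R%:E <=
    \int[iid_prob P n]_y
      (abs_cost (tuple_cons (x, y)) (t (tuple_cons (x, y))))%:E)%E.
  under eq_integral do rewrite costE EFinD.
  rewrite ge0_integralD//; last 2 first.
  - by move=> y _; rewrite lee_fin abs_cost_ge0.
  - by apply/measurable_EFinP; apply: measurable_abs_cost => i; exact: mt'.
  rewrite integral_probability_cst EFinD leeD2l//.
  apply: IH => //.
  - by move=> y z i e; apply: ant; rewrite lift0 /= e.
  - move=> y; have := sequential_from_behead _ _ _ (seqt (tuple_cons (x, y))).
    by rewrite t0E.
have mF := measurable_integral_iid_prob P n _ mf f0.
case: j seqt step => [|j] seqt step.
(* No contract is running, so the first applicant is hired for some [k + 1] steps and [step_bound]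
   applies pointwise. *)
- rewrite subn0 (le_trans (integral_step_bound n))//.
  apply: ge0_le_integral => //.
  + by move=> x _; rewrite lee_fin addr_ge0// !mulr_ge0 ?sqrtr_ge0.
  + by apply/measurable_EFinP; exact: measurable_step_bound.
  move=> x _; apply: le_trans (step x); rewrite lee_fin add0n.
  have := sequential_from_head _ _ _ (seqt (tuple_cons (x, y0))).
  by rewrite -/(t0 x) eqxx; case: (t0 x) => // k _; exact: step_bound_le.
(* The first step is already covered: its applicant gets duration 0 and the induction hypothesis
   alone suffices. *)
- rewrite subSS -(integral_probability_cst _ _ _ P).
  apply: ge0_le_integral => //.
  move=> x _; apply: le_trans (step x); rewrite lee_fin.
  have := sequential_from_head _ _ _ (seqt (tuple_cons (x, y0))).
  by rewrite -/(t0 x); case: (t0 x) => //= _; rewrite addn0 mul0r add0r.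
Qed.

End online_lower_bound.

(** * Rules do not look ahead; the final comparison *)

Lemma decisions_take (R : realType) (A : seq R -> seq nat -> nat) xs ys k m :
  (k <= m)%N -> take m xs = take m ys -> decisions A xs k = decisions A ys k.
Proof.
move=> + e; elim: k => //= k IH km; rewrite IH 1?ltnW//.
by rewrite -(take_takel xs km) e take_takel.
Qed.

Lemma best_online_ge (R : realType) (n : nat) :
  ((5^-1 * Num.sqrt n%:R)%R%:E <= best_online R n)%E.
Proof.
apply: le_ereal_inf_tmp => _ [A [mA seqA] <-].
rewrite expected_costE//; have := @abs_cost_lower_bound R n 0 (durations A).
rewrite subn0; apply.
- by move=> i; exact: mA.
- move=> x y i e; rewrite !durationsE e; congr (A _ _).
  by apply: decisions_take e.
- by move=> x; apply: sequential_from0; exact: seqA.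
Qed.

Theorem theorem7p7 (R : realType) :
  (fun n : nat => fine (best_online R n) / fine (expected_opt R n))
    =Theta_\oo (fun n : nat => Num.sqrt n%:R / ln n%:R).
Proof.
rewrite eqThetaE qualifE; apply/asboolP.
(* Once [ln n >= 1], the expected optimum lies between [ln n / 4] and [2 (1 + ln n) <= 4 ln n].
   Dividing the bounds [sqrt n / 5] and [2 sqrt n] by these gives [1 / 20] and [8]. *)
exists (20^-1, 8); first by rewrite /= invr_gt0 !ltr0n.
near=> n; rewrite /=.
have n0 : (0 < n)%N by near: n; exact: nbhs_infty_gt.
have ln1 : 1 <= ln n%:R :> R.
  rewrite -[leLHS]expRK ler_ln ?posrE ?expR_gt0 ?ltr0n//.
  by near: n; exact: nbhs_infty_ger.
have s0 : 0 <= Num.sqrt n%:R :> R := sqrtr_ge0 _.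
have := best_online_le R n n0; have := best_online_ge R n.
(* The two real bounds rule out infinite values, so [fine] is faithful here. *)
case: (best_online R n) => // E; rewrite !lee_fin => E1 E2.
have := expected_opt_le n (R := R); have := expected_opt_ge n (R := R).
case: (expected_opt R n) => // O; rewrite !lee_fin /= => O1 O2.
have H1 : \sum_(s < n) s.+1%:R^-1 <= 1 + ln n%:R :> R.
  by have := @harmonic_le_ln R n.-1; rewrite prednK.
have H2 : ln n%:R <= \sum_(s < n) s.+1%:R^-1 :> R.
  by rewrite (le_trans _ (ln_le_harmonic n))// ler_ln ?posrE ?ltr0n// ler_nat.
have l0 : 0 < ln n%:R :> R by lra.
have O0 : 0 < O by lra.
have E0 : 0 <= E by lra.
rewrite !ger0_norm ?divr_ge0 ?(ltW l0) ?(ltW O0)//; split.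
  rewrite ler_pdivlMr// mulrA mulrAC ler_pdivrMr//.
  nra.
rewrite ler_pdivrMr// mulrA mulrAC ler_pdivlMr//.
nra.
Unshelve. all: by end_near. Qed.
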